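(* Let $R$ be a commutative ring with identity, let $n\ge 0$ be an integer, and let $p_0,p_1,\ldots,p_n\in R$. Then \[\sum_{i=0}^np_i=\left|\begin{array}{rrrrrr} p_0&p_{1}&p_{2}&\cdots&p_{n-1}&p_n\\ -1&1&0&\cdots&0&0\\ 0&-1&1&\cdots&0&0\\ \vdots&\vdots&\vdots&\ddots&\vdots&\vdots\\ 0&0&0&\cdots&1&0\\ 0&0&0&\cdots&-1&1\end{array}\right|,\] where the determinant has size $n+1$; that is, the matrix has first row $(p_0,p_1,\ldots,p_n)$, diagonal entries equal to $1$ in rows $2,\ldots,n+1$, all subdiagonal entries equal to $-1$, and all other entries $0$. *)

(* Defs.v *)
From mathcomp Require Import all_boot all_algebra.
Set Implicit Arguments.
Unset Strict Implicit.
Unset Printing Implicit Defensive.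
Import GRing.Theory.
Local Open Scope ring_scope.

(* Indices start at 0, so row 0 is (p_0, ..., p_n). *)
Definition sum_mx (R : comPzRingType) (n : nat) (p : 'I_n.+1 -> R) :
    'M[R]_n.+1 :=
  \matrix_(i < n.+1, j < n.+1)
    if i == 0%N :> nat then p j
    else if i == j :> nat then 1
    else if i == j.+1 :> nat then -1
    else 0.

(* Main.v *)
Require Import Defs.
From mathcomp Require Import all_boot all_algebra.
Local Open Scope ring_scope.

(** Adding to each column all the columns on its right does not change the
    determinant; it amounts to multiplying on the right by the unitriangular
    matrix whose entries on and below the diagonal are all equal to 1.  In the
    rows of index at least 1, the suffix sums of (0, .., -1, 1, .., 0)
    telescope and leave the corresponding row of the identity matrix, while the
    first row becomes the row of suffix sums of p, which starts with the
    complete sum.  The product is therefore upper triangular with diagonal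
    (p_0 + .. + p_n, 1, .., 1), whence the formula. *)

Import GRing.Theory.

Definition lower_ones_mx (R : comPzRingType) (n : nat) : 'M[R]_n :=
  \matrix_(i < n, j < n) (j <= i)%N%:R.

Lemma det_lower_ones_mx (R : comPzRingType) (n : nat) :
  \det (lower_ones_mx R n) = 1.
Proof.
rewrite det_trig; last first.
  by apply/is_trig_mxP => i j lt_ij; rewrite mxE leqNgt lt_ij.
by rewrite big1 // => i _; rewrite mxE leqnn.
Qed.

Lemma sum_mx_mul_lower_ones_row0 (R : comPzRingType) (n : nat)
    (p : 'I_n.+1 -> R) (j : 'I_n.+1) :
  (sum_mx p *m lower_ones_mx R n.+1) ord0 j = \sum_(k < n.+1 | (j <= k)%N) p k.
Proof.
rewrite mxE [RHS]big_mkcond; apply: eq_bigr => k _; rewrite !mxE /=.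
by case: leqP => _; rewrite ?mulr1 ?mulr0.
Qed.

(** Row i of the product is the difference of rows i and i - 1 of the right
    factor: its entry in column j is
    [j <= i] - [j <= i - 1] = [i = j]. *)
Lemma sum_mx_mul_lower_ones_rowS (R : comPzRingType) (n : nat)
    (p : 'I_n.+1 -> R) (i j : 'I_n.+1) :
  (0 < i)%N -> (sum_mx p *m lower_ones_mx R n.+1) i j = (i == j)%:R.
Proof.
move=> i_gt0.
have lt_pred : (i.-1 < n.+1)%N by rewrite (leq_ltn_trans (leq_pred i)).
pose i' := Ordinal lt_pred.
have i'i : (i' : nat).+1 = i by rewrite /= prednK.
have neq_i'i : i' != i by rewrite -val_eqE /= -i'i /= neq_ltn ltnSn.
rewrite mxE (bigD1 i) //= (bigD1 i') //= big1 ?addr0 => [|k /andP[ki ki']].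
  rewrite !mxE (gtn_eqF i_gt0) eqxx -!i'i gtn_eqF // eqxx mul1r mulN1r.
  have -> : (i == j) = (j == i'.+1 :> nat) by rewrite i'i eq_sym.
  rewrite leq_eqVlt ltnS.
  by case: eqP => [->|_]; rewrite /= ?ltnn ?subr0 ?subrr.
rewrite !mxE (gtn_eqF i_gt0) [i == k :> nat]eq_sym val_eqE (negPf ki).
by rewrite -i'i eqSS eq_sym val_eqE (negPf ki') mul0r.
Qed.

Theorem mainTheorem9 (R : comPzRingType) (n : nat) (p : 'I_n.+1 -> R) :
  \sum_(i < n.+1) p i = \det (sum_mx p).
Proof.
rewrite -[RHS]mulr1 -(det_lower_ones_mx R n.+1) -det_mulmx -det_tr det_trig.
  rewrite big_ord_recl mxE sum_mx_mul_lower_ones_row0.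
  rewrite [X in _ * X]big1 ?mulr1 // => i _.
  by rewrite mxE sum_mx_mul_lower_ones_rowS // eqxx.
apply/is_trig_mxP => i j lt_ij; rewrite mxE sum_mx_mul_lower_ones_rowS.
  by rewrite -val_eqE /= (gtn_eqF lt_ij).
exact: leq_ltn_trans lt_ij.
Qed.
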